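(* Let $k,I>0$ and $\alpha_2>\alpha_1\ge0$ with $\alpha_1\notin\mathbb{N}$, $\alpha_2\in\mathbb{N}$ and $\lceil\alpha_1\rceil+1\le\alpha_2$. Let $u_0^{(i)}\in\mathbb{R}$, $i=0,\dots,\alpha_2-1$, be given, and let $f:[0,I]\times\mathbb{R}\to\mathbb{R}$ be continuous. Define $$G=\Big\{(t,v):t\in[0,I],\ |v|\le\frac{I^{\lceil\alpha_1\rceil-\alpha_1}}{\Gamma(\lceil\alpha_1\rceil-\alpha_1+1)}\Big(k+\sum_{i=0}^{\alpha_2-\lceil\alpha_1\rceil-1}\frac{I^i}{i!}\big|u_0^{(i+\lceil\alpha_1\rceil)}\big|\Big)\Big\}$$ and $M:=\sup_{(t,v)\in G}|f(t,v)|$. Set $h:=I$ if $M=0$, and otherwise $$h:=\min\Big\{I,\Big(\frac{k\,\Gamma(\alpha_2-\lceil\alpha_1\rceil+1)}{M}\Big)^{\frac{1}{\alpha_2-\lceil\alpha_1\rceil}}\Big\}.$$ Then the initial value problem $$D^{\alpha_2}u(t)=f\big(t,D^{\alpha_1}u(t)\big),\qquad u^{(i)}(0)=u_0^{(i)},\ i=0,1,\dots,\alpha_2-1,$$ has at least one solution $u\in C^{\alpha_2}[0,h]$ on $[0,h]$.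
   Context: $\lceil\cdot\rceil$ is the ceiling function and $\mathbb{N}=\{1,2,\dots\}$. For $\delta>0$ the Riemann–Liouville integral is $J^\delta u(t)=\frac{1}{\Gamma(\delta)}\int_0^t(t-s)^{\delta-1}u(s)\,ds$, and $J^0$ is the identity. For $\beta\ge0$ the Caputo derivative is $D^\beta u=J^{\lceil\beta\rceil-\beta}u^{(\lceil\beta\rceil)}$ (so $D^{\alpha_2}u=u^{(\alpha_2)}$ for integer $\alpha_2$). A solution on $[0,h]$ is a function satisfying the differential equation for all $t\in[0,h]$ together with the initial conditions. *)

(* Defs.v *)
From HB Require Import structures.
From mathcomp Require Import all_boot all_order all_algebra.
From mathcomp Require Import all_classical all_reals all_analysis.
Set Implicit Arguments. Unset Strict Implicit. Unset Printing Implicit Defensive.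
Import Order.TTheory GRing.Theory Num.Theory.
Import numFieldNormedType.Exports.
Local Open Scope classical_set_scope.
Local Open Scope ring_scope.

Section Defs.
Variable R : realType.

Definition ceiln (x : R) : nat := `|Num.ceil x|%N.

(* Euler Gamma function (used only at positive arguments):
   Gamma x = \int_0^oo s^(x-1) e^(-s) ds *)
Definition Gamma (x : R) : R :=
  fine (\int[@lebesgue_measure R]_(s in `]0%R, +oo[) (powR s (x - 1) * expR (- s))%:E)%E.

Definition RLint (delta : R) (v : R -> R) (t : R) : R :=
  if delta == 0 then v t
  else (Gamma delta)^-1 *
       fine (\int[@lebesgue_measure R]_(s in `[0%R, t])
               (powR (t - s) (delta - 1) * v s)%:E)%E.

(* Caputo derivative D^beta u = J^(ceil beta - beta) u^(ceil beta), where
   U k is the k-th derivative of u (U 0 = u). *)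
Definition caputo (U : nat -> R -> R) (beta : R) (t : R) : R :=
  RLint ((ceiln beta)%:R - beta) (U (ceiln beta)) t.

(* l is the derivative of g at t relative to the set A (one-sided at endpoints
   of an interval) *)
Definition is_derive_within (A : set R) (g : R -> R) (t l : R) : Prop :=
  (fun s => (g s - g t) / (s - t)) @ within A t^' --> l.

(* U 0, ..., U m are the successive derivatives on [0,h] of U 0, and U m is
   continuous on [0,h]: U 0 is in C^m[0,h] *)
Definition Cm_on (m : nat) (h : R) (U : nat -> R -> R) : Prop :=
  (forall k, (k < m)%N -> forall t, 0 <= t <= h ->
      is_derive_within `[0, h] (U k) t (U k.+1 t)) /\
  {within `[0, h], continuous (U m)}.

End Defs.

(* Main.v *)
Require Import Defs.
From HB Require Import structures.
From mathcomp Require Import all_boot all_order all_algebra.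
From mathcomp Require Import all_classical all_reals all_analysis.
From mathcomp Require Import measurable_realfun lra ring.
Set Implicit Arguments.
Unset Strict Implicit.
Unset Printing Implicit Defensive.
Import Order.TTheory GRing.Theory Num.Theory.
Import numFieldNormedType.Exports.
Local Open Scope classical_set_scope.
Local Open Scope ring_scope.

(** With [n1 = ceil alpha1], [m = alpha2 - n1 >= 1] and [d = n1 - alpha1], the
    function [w = u^(n1)] must satisfy [w = T w], where [T w] is the [m]-fold
    primitive, with the prescribed initial values, of [s |-> f s (J^d w s)]. The
    choice of [h] makes [T] preserve the functions bounded by
    [k + sum_i I^i / i! |u0 (i + n1)|] and Lipschitz with a fixed constant, once
    [f] is extended continuously to the plane by clamping its arguments to [G];
    [T] is uniformly continuous there for the sup norm, and causal: [T w t] only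
    depends on [w] on [[0, t]]. Delaying [T] by a small [eta] (Tonelli) turns
    Picard iteration into a process that becomes stationary, which gives
    approximate fixed points; Tychonoff's theorem and equicontinuity extract
    from them a fixed point. *)

(** * Fixed points of causal operators *)

Section bounded_lipschitz.
Variables (R : realType) (h B L : R).
Hypotheses (h0 : 0 < h) (B0 : 0 <= B) (L0 : 0 <= L).

(** The bounds are imposed on the whole line, so that Tychonoff's theorem applies to plain functions
    [R -> R]; the operator used later clamps its argument to [[0, h]]. *)
Definition bounded_lipschitz (w : R -> R) : Prop :=
  (forall t, `|w t| <= B) /\ (forall s t, `|w s - w t| <= L * `|s - t|).

Lemma small_step e : 0 < e ->
  exists2 q : nat, (0 < q)%N & L * (h / q%:R) <= e.
Proof.
move=> e0; exists (Num.Def.truncn (L * h / e)).+1 => //.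
have q0 : 0 < (Num.Def.truncn (L * h / e)).+1%:R :> R by rewrite ltr0n.
have /ltW := truncnS_gt (L * h / e).
by rewrite ler_pdivrMr// mulrA ler_pdivrMr// [e * _]mulrC.
Qed.

(** A form of Arzelà-Ascoli: compactness of a product of segments gives a cluster point for
    pointwise convergence, and the common Lipschitz constant turns closeness on a finite grid into
    uniform closeness on [[0, h]]. Closeness for arbitrarily large [n] stands in for a convergent
    subsequence. *)
Lemma bounded_lipschitz_cluster (w_ : nat -> R -> R) :
  (forall n, bounded_lipschitz (w_ n)) ->
  exists2 w, bounded_lipschitz w &
    forall e, 0 < e -> forall N, exists2 n, (N <= n)%N &
      forall t, 0 <= t <= h -> `|w_ n t - w t| <= e.
Proof.
move=> Xw.
pose K := [set g : {ptws R -> R} | forall t, `[- B, B]%classic (g t)].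
have cK : compact K.
  by apply: (@tychonoff R (fun=> R) (fun=> `[- B, B]%classic)) => _;
    exact: segment_compact.
pose v_ : nat -> {ptws R -> R} := w_.
have FK : (v_ @ \oo) K.
  exists 0%N => // n _ t /=; rewrite in_itv/= -ler_norml.
  by have [] := Xw n.
have [w [Kw clw]] := cK (v_ @ \oo) _ FK.
(* A neighbourhood in the product topology controls finitely many coordinates, here the points of
   the list [T]. *)
have approx (e : R) N (T : seq R) : 0 < e ->
    exists2 n, (N <= n)%N & forall t, t \in T -> `|w_ n t - w t| < e.
  move=> e0.
  have near_pt : nbhs w
      [set g : {ptws R -> R} | forall t, t \in T -> `|g t - w t| < e].
    elim: T => [|t T ih]; first by apply: filterS filterT.
    have : nbhs w [set g : {ptws R -> R} | `|g t - w t| < e].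
      have ball_wt : nbhs w [set g : {ptws R -> R} | ball (w t) e (g t)].
        exact: (@proj_continuous R (fun=> R) t w _ (nbhsx_ballx (w t) e e0)).
      by apply: filterS ball_wt => g /=; rewrite /ball/= distrC.
    move: ih; apply: filterS2 => g /= gT gt s.
    by rewrite inE => /orP[/eqP ->//|]; exact: gT.
  have ev : (v_ @ \oo) [set v_ n | n in [set n | (N <= n)%N]].
    by exists N => // n Nn; exists n.
  have [g [[n Nn <-] gT]] := clw _ _ ev near_pt.
  by exists n.
(* Each Lipschitz inequality involves two points only, so it survives the pointwise limit. *)
have Xw0 : bounded_lipschitz w.
  split=> [t|s t]; first by have := Kw t; rewrite /= in_itv/= -ler_norml.
  apply/ler_addgt0Pr => e e0.
  have e20 : 0 < e / 2 by rewrite divr_gt0.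
  have [n _ H] := approx (e / 2) 0%N [:: s; t] e20.
  have /ltW h1 := H s (mem_head _ _).
  have /ltW h2 : `|w_ n t - w t| < e / 2 by apply: H; rewrite !inE eqxx orbT.
  have [_ /(_ s t) h3] := Xw n.
  have -> : w s - w t = (w_ n s - w_ n t) - (w_ n s - w s) + (w_ n t - w t)
    by lra.
  rewrite (le_trans (ler_normD _ _))//.
  have := ler_normB (w_ n s - w_ n t) (w_ n s - w s).
  lra.
exists w => // e e0 N.
have e30 : 0 < e / 3 by rewrite divr_gt0.
have [q q0 Lq] := small_step e30.
have q0' : 0 < q%:R :> R by rewrite ltr0n.
have [n Nn H] := approx (e / 3) N [seq h * i%:R / q%:R | i <- iota 0 q.+1] e30.
exists n => // t /andP[t0 th].
(* The grid point [x] of index [i] is the last one at or below [t], hence at distance at most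
   [h / q]. *)
pose i := Num.Def.truncn (t * q%:R / h).
have /andP[it ti] : (i%:R <= t * q%:R / h < i.+1%:R).
  by apply: truncn_itv; rewrite divr_ge0 ?mulr_ge0// ltW.
pose x := h * i%:R / q%:R.
have xt : x <= t by rewrite /x ler_pdivrMr// -ler_pdivlMl// mulrC.
have tx : t - x <= h / q%:R.
  rewrite /x lerBlDr -mulrDl -[X in X + _]mulr1 -mulrDr nat1r ler_pdivlMr//.
  by rewrite -ler_pdivrMl// mulrC ltW.
have ttx : `|t - x| <= h / q%:R by rewrite ger0_norm ?subr_ge0.
have Lx : L * `|t - x| <= e / 3 by rewrite (le_trans _ Lq)// ler_wpM2l.
have /ltW h1 : `|w_ n x - w x| < e / 3.
  apply: H; apply/mapP; exists i => //.
  rewrite mem_iota/= add0n ltnS -(ler_nat R) (le_trans it)//.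
  by rewrite ler_pdivrMr// mulrC ler_wpM2l.
have [_ /(_ t x) h2] := Xw n.
have [_ /(_ t x) h3] := Xw0.
have -> : w_ n t - w t = (w_ n t - w_ n x) - (w t - w x) + (w_ n x - w x)
  by lra.
rewrite (le_trans (ler_normD _ _))//.
have := ler_normB (w_ n t - w_ n x) (w t - w x).
lra.
Qed.

Variable T : (R -> R) -> R -> R.
Hypothesis T_stable : forall w, bounded_lipschitz w -> bounded_lipschitz (T w).
Hypothesis T_init : forall v w, T v 0 = T w 0.
Hypothesis T_causal : forall v w t, 0 <= t <= h ->
  (forall s, 0 <= s <= t -> v s = w s) -> T v t = T w t.
Hypothesis T_unif : forall e, 0 < e -> exists2 d, 0 < d &
  forall v w, bounded_lipschitz v -> bounded_lipschitz w ->
    (forall s, 0 <= s <= h -> `|v s - w s| <= d) ->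
    forall t, 0 <= t <= h -> `|T v t - T w t| <= e.

(* Tonelli's trick: delaying T by eta makes Picard iteration stationary on
   [0, j eta] after j + 1 steps, by causality. *)
Lemma causal_approx_fixpoint e : 0 < e -> exists2 w, bounded_lipschitz w &
  forall t, 0 <= t <= h -> `|w t - T w t| <= e.
Proof.
move=> e0; have [q q0 Lq] := small_step e0.
have q0' : 0 < q%:R :> R by rewrite ltr0n.
pose eta := h / q%:R.
have eta0 : 0 < eta by rewrite divr_gt0.
pose delay t : R := Num.max 0 (t - eta).
have delay_ge0 t : 0 <= delay t by rewrite /delay le_max lexx.
have delay_lip s t : `|delay s - delay t| <= `|s - t|.
  have := ler_norm (s - t); have := ler_norm (t - s); rewrite (distrC t) => *.
  rewrite ler_norml /delay !maxEle.
  by apply/andP; split; do 2 case: ifPn; rewrite -?ltNge => *; lra.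
pose W j := iter j (fun w t => T w (delay t)) (fun=> 0).
have XW j : bounded_lipschitz (W j).
  elim: j => [|j /T_stable[wB wL]].
    by split=> [t|s t]; rewrite /= ?subrr normr0// mulr_ge0.
  by split=> [t|s t]/=; [exact: wB|rewrite (le_trans (wL _ _))// ler_wpM2l].
(* In the inductive step both sides are values of [T] at [delay t], which only see their arguments
   on [[0, delay t]], where the induction hypothesis applies; [T_init] starts the induction at
   [t = 0]. *)
have stat j t : 0 <= t <= h -> t <= j%:R * eta -> W j.+2 t = W j.+1 t.
  elim: j t => [|j ih] t /andP[t0 th].
    rewrite mul0r => tle0; have -> : t = 0 by lra.
    have /= -> : delay 0 = 0 by rewrite /delay; apply/max_idPl; lra.
    exact: T_init.
  move=> tj; apply: T_causal => [|s /andP[s0 sd]].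
    by rewrite delay_ge0 /delay/= ge_max; apply/andP; split; lra.
  move: sd; rewrite /delay le_max => /orP[s0'|st]; apply: ih.
  - by apply/andP; split; lra.
  - by rewrite (le_trans s0')// mulr_ge0// ltW.
  - by apply/andP; split; lra.
  - by move: tj; rewrite -natr1 mulrDl mul1r; lra.
(* Stationarity gives [W q.+1 t = T (W q.+1) (delay t)] on all of [[0, q eta] = [0, h]]; removing
   the delay costs [L * eta <= e]. *)
exists (W q.+1) => // t t0h.
have tq : t <= q%:R * eta by rewrite mulrC divfK ?gt_eqF//; case/andP: t0h.
rewrite -{1}(stat q)//=.
have [_ TL] := T_stable (XW q.+1).
rewrite (le_trans (TL _ _))// (le_trans _ Lq)// ler_wpM2l//.
case/andP: t0h => t0 th; rewrite -/eta ler_norml /delay maxEle.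
by apply/andP; split; case: ifPn; rewrite -?ltNge => *; lra.
Qed.

(** A cluster point of [1 / (n + 1)]-approximate fixed points is a fixed point, since [T_unif]
    carries uniform closeness through [T]. *)
Lemma causal_fixpoint : exists2 w, bounded_lipschitz w &
  forall t, 0 <= t <= h -> w t = T w t.
Proof.
have /choice[w_ wP] (n : nat) : exists w, bounded_lipschitz w /\
    forall t, 0 <= t <= h -> `|w t - T w t| <= n.+1%:R^-1.
  by have [|w ? ?] := @causal_approx_fixpoint n.+1%:R^-1;
    [rewrite invr_gt0 ltr0n|exists w].
have [w Xw clw] := bounded_lipschitz_cluster (fun n => (wP n).1).
exists w => // t t0h.
apply/eqP; rewrite -subr_eq0 -normr_le0; apply/ler_addgt0Pr => e e0.
rewrite add0r.
have e30 : 0 < e / 3 by rewrite divr_gt0.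
have [d d0 dP] := T_unif e30.
pose N := Num.Def.truncn (e / 3)^-1.
have de0 : 0 < Num.min d (e / 3) by rewrite lt_min d0.
have [n Nn wn] := clw _ de0 N.
have h1 : `|w_ n t - w t| <= e / 3.
  by rewrite (le_trans (wn t t0h))// ge_min lexx orbT.
have h2 : `|T (w_ n) t - T w t| <= e / 3.
  apply: dP => //; first exact: (wP n).1.
  by move=> s s0h; rewrite (le_trans (wn s s0h))// ge_min lexx.
have h3 : `|w_ n t - T (w_ n) t| <= e / 3.
  rewrite (le_trans ((wP n).2 _ t0h))// invf_ple ?posrE//.
  by rewrite (le_trans (ltW (truncnS_gt _)))// ler_nat ltnS.
have -> : w t - T w t =
    (w_ n t - T (w_ n) t) - (w_ n t - w t) + (T (w_ n) t - T w t) by lra.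
rewrite (le_trans (ler_normD _ _))//.
have := ler_normB (w_ n t - T (w_ n) t) (w_ n t - w t).
lra.
Qed.

End bounded_lipschitz.

(** * The Gamma function *)

Section gamma_function.
Variable R : realType.
Notation mu := (@lebesgue_measure R).

(** Two-sided hypotheses at every point of the closed interval replace the one-sided limits asked by
    [continuous_FTC2], and [a = b] is allowed. *)
Lemma is_derive_FTC2 (f F : R -> R) (a b : R) : a <= b ->
  (forall x, a <= x <= b -> {for x, continuous f}) ->
  (forall x, a <= x <= b -> is_derive x 1 F (f x)) ->
  (\int[mu]_(x in `[a, b]) (f x)%:E = (F b - F a)%:E)%E.
Proof.
rewrite le_eqVlt => /predU1P[<-|ab] cf dF.
  by rewrite set_itv1 integral_set1 subrr.
have cF x : a <= x <= b -> {for x, continuous F}.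
  by move=> /dF ?; apply: differentiable_continuous; apply/derivable1_diffP.
have aab : a <= a <= b by rewrite lexx ltW.
have bab : a <= b <= b by rewrite lexx ltW.
rewrite (@continuous_FTC2 _ f F)//.
- apply/continuous_within_itvP => //; split.
  + by move=> x; rewrite in_itv/= => /andP[/ltW ? /ltW ?]; apply/cf/andP.
  + exact/cvg_at_right_filter/cf.
  + exact/cvg_at_left_filter/cf.
- split.
  + move=> x; rewrite in_itv/= => /andP[ax xb].
    by have [] : is_derive x 1 F (f x) by apply/dF; rewrite !ltW.
  + exact/cvg_at_right_filter/cF.
  + exact/cvg_at_left_filter/cF.
- move=> x; rewrite in_itv/= => /andP[ax xb].
  by rewrite derive1E; apply: derive_val; apply/dF; rewrite !ltW.
Qed.

Lemma is_derive_RFTC2 (f F : R -> R) (a b : R) : a <= b ->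
  (forall x, a <= x <= b -> {for x, continuous f}) ->
  (forall x, a <= x <= b -> is_derive x 1 F (f x)) ->
  (\int[mu]_(x in `[a, b]) f x = F b - F a)%R.
Proof.
by move=> ab cf dF; have := is_derive_FTC2 ab cf dF; rewrite /Rintegral => ->.
Qed.

Lemma continuous_powR_pt (a x : R) : 0 < x -> {for x, continuous (@powR R ^~ a)}.
Proof.
move=> x0; apply: differentiable_continuous; apply/derivable1_diffP.
by apply: derivable_powR; rewrite in_itv/= x0.
Qed.

Definition gamma_density (x s : R) : R := s `^ (x - 1) * expR (- s).

Lemma gamma_density_ge0 x s : 0 <= gamma_density x s.
Proof. by rewrite mulr_ge0 ?powR_ge0 ?expR_ge0. Qed.

Lemma continuous_gamma_density x s : 0 < s ->
  {for s, continuous (gamma_density x)}.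
Proof.
move=> s0; apply: cvgM; first exact: continuous_powR_pt.
by apply: continuous_comp; [exact: opp_continuous|exact: continuous_expR].
Qed.

Lemma measurable_gamma_density x : measurable_fun setT (gamma_density x).
Proof.
apply: measurable_funM; first exact: measurable_powR.
by apply: measurableT_comp; [exact: measurable_expR|exact: oppr_measurable].
Qed.

(** Both ends of []0, +oo[] are cut off: on this segment the density is continuous, so integration
    by parts applies, and monotone convergence recovers the full integral. *)
Definition gamma_trunc (x : R) (n : nat) : R :=
  \int[mu]_(s in `[n.+1%:R^-1, n.+1%:R]) gamma_density x s.

Lemma inv_natS_gt0 n : 0 < n.+1%:R^-1 :> R. Proof. by rewrite invr_gt0. Qed.

Lemma inv_natS_le n : n.+1%:R^-1 <= n.+1%:R :> R.
Proof. by rewrite (@le_trans _ _ 1)// ?invf_le1// ler1n. Qed.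

Lemma integrable_gamma_density x n :
  mu.-integrable `[n.+1%:R^-1, n.+1%:R] (EFin \o gamma_density x).
Proof.
apply: continuous_compact_integrable; first exact: segment_compact.
apply/continuous_in_subspaceT => s; rewrite inE/= in_itv/= => /andP[ns _].
exact/continuous_gamma_density/(lt_le_trans (inv_natS_gt0 n)).
Qed.

Lemma gamma_truncE x n : (gamma_trunc x n)%:E =
  (\int[mu]_(s in `[n.+1%:R^-1%R, n.+1%:R%R]) (gamma_density x s)%:E)%E.
Proof.
by rewrite /gamma_trunc /Rintegral fineK//; apply: integrable_fin_num => //;
  exact: integrable_gamma_density.
Qed.

(** Kept in the extended reals because [fine] sends an infinite integral to 0, so that finiteness
    must be tracked separately. *)
Definition gamma_integral (x : R) : \bar R :=
  (\int[mu]_(s in `]0%R, +oo[) (gamma_density x s)%:E)%E.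

Lemma GammaE x : Gamma x = fine (gamma_integral x). Proof. by []. Qed.

Lemma cvg_gamma_trunc x : (gamma_trunc x n)%:E @[n --> \oo] --> gamma_integral x.
Proof.
under eq_fun do rewrite gamma_truncE.
rewrite /gamma_integral.
have -> : `]0%R, +oo[%classic =
    \bigcup_n `[n.+1%:R^-1, n.+1%:R]%classic :> set R.
  apply/seteqP; split => s /=; rewrite ?in_itv/= ?andbT.
    move=> s0; exists (Num.Def.truncn (Num.max s s^-1)) => //=.
    have : Num.max s s^-1 < (Num.Def.truncn (Num.max s s^-1)).+1%:R.
      exact: truncnS_gt.
    rewrite gt_max => /andP[s1 s2]; rewrite in_itv/= (ltW s1) andbT.
    by rewrite invf_ple ?posrE// ltW.
  by case=> n _; rewrite /= in_itv/= => /andP[+ _]; apply: lt_le_trans.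
apply: ge0_nondecreasing_set_cvg_integral => //.
- apply/nondecreasing_seqP => n; rewrite subsetEset; apply: subset_itv.
    by rewrite bnd_simp lef_pV2 ?posrE// ler_nat.
  by rewrite bnd_simp ler_nat.
- move=> n; apply/measurable_EFinP.
  by apply: measurable_funTS; exact: measurable_gamma_density.
- by move=> n s _; rewrite lee_fin gamma_density_ge0.
Qed.

Lemma gamma_integral_cvg x (l : R) : gamma_trunc x n @[n --> \oo] --> l ->
  gamma_integral x = l%:E.
Proof.
move=> gl; have : (gamma_trunc x n)%:E @[n --> \oo] --> l%:E.
  by apply: cvg_EFin => //; exact: nearW.
by move/cvg_lim <- => //; apply/esym/cvg_lim => //; exact: cvg_gamma_trunc.
Qed.

Lemma powR_le1D (x s : R) : 0 <= x <= 1 -> 0 < s -> s `^ x <= 1 + s.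
Proof.
move=> /andP[x0 x1] s0; have [s1|s1] := leP 1 s.
  by rewrite (le_trans (ler1_powR s1 x1))// lerDr.
have sx1 : s `^ x <= s `^ 0 by rewrite ger_powR// s0 ltW.
by rewrite (le_trans sx1)// powRr0 lerDl ltW.
Qed.

(** The product rule, written with densities: integrating it is the integration by parts behind the
    functional equation of Gamma. *)
Lemma is_derive_powR_expRN (x s : R) : 0 < s ->
  is_derive s 1 (fun s : R => s `^ x * expR (- s))
    (x * gamma_density x s - gamma_density (x + 1) s).
Proof.
move=> s0; have ? := is_derive1_powR x s0.
apply: is_derive_eq; rewrite /gamma_density addrK /GRing.scale/=.
by ring.
Qed.

Lemma gamma_trunc_rec x n : 0 < x ->
  gamma_trunc (x + 1) n = x * gamma_trunc x n -
    (n.+1%:R `^ x * expR (- n.+1%:R) -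
     n.+1%:R^-1 `^ x * expR (- n.+1%:R^-1)).
Proof.
move=> x0.
pose G s : R := s `^ x * expR (- s).
have : (\int[mu]_(s in `[n.+1%:R^-1, n.+1%:R])
    (x * gamma_density x s - gamma_density (x + 1) s) =
    G n.+1%:R - G n.+1%:R^-1)%R.
  apply: is_derive_RFTC2; first exact: inv_natS_le.
  - move=> s /andP[ns _]; have s0 := lt_le_trans (inv_natS_gt0 n) ns.
    apply: cvgB; last exact: continuous_gamma_density.
    by apply: cvgM; [exact: cvg_cst|exact: continuous_gamma_density].
  - move=> s /andP[ns _]; apply: is_derive_powR_expRN.
    exact: (lt_le_trans (inv_natS_gt0 n) ns).
rewrite RintegralB//; last 2 first.
- exact: (integrableZl _ x (integrable_gamma_density x n)).
- exact: integrable_gamma_density.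
rewrite RintegralZl//; last exact: integrable_gamma_density.
by rewrite -!/(gamma_trunc _ n) /G => <-; ring.
Qed.

(** With [N >= x], the inequality [1 + y ^ (N + 1) / (N + 1)! <= exp y] bounds [y ^ x / exp y] by
    [(N + 1)! / y] for [y >= 1]. *)
Lemma cvg_powR_expRN (x : R) :
  n.+1%:R `^ x * expR (- n.+1%:R) @[n --> \oo] --> (0 : R).
Proof.
pose N := (Num.Def.truncn x).+1.
have xN : x <= N%:R by rewrite ltW// truncnS_gt.
apply: (@squeeze_cvgr _ _ _ _ (fun=> 0) (fun n => N.+1`!%:R * harmonic n)).
- apply: nearW => n; rewrite mulr_ge0 ?powR_ge0 ?expR_ge0//=.
  rewrite expRN ler_pdivrMr ?expR_gt0// -mulrA.
  have n1 : 1 <= n.+1%:R :> R by rewrite ler1n.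
  rewrite (le_trans (ler_powR n1 xN))// powR_mulrn//.
  rewrite /harmonic/= mulrCA ler_pdivlMl ?ltr0n// -exprS.
  have := @expR_ge1Dxn R n.+1%:R N (ler0n _ _).
  rewrite -ler_pdivrMl ?ltr0n ?fact_gt0// mulrC.
  lra.
- exact: cvg_cst.
- by rewrite -(mulr0 N.+1`!%:R); apply: cvgM; [exact: cvg_cst|exact: cvg_harmonic].
Qed.

Lemma cvg_powR_harmonic (x : R) : 0 < x ->
  n.+1%:R^-1 `^ x * expR (- n.+1%:R^-1) @[n --> \oo] --> (0 : R).
Proof.
move=> x0.
apply: (@squeeze_cvgr _ _ _ _ (fun=> 0) (fun n => n.+1%:R^-1 `^ x)).
- apply: nearW => n; rewrite mulr_ge0 ?powR_ge0 ?expR_ge0//=.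
  by rewrite ler_piMr ?powR_ge0// expR_le1 oppr_le0 ltW// inv_natS_gt0.
- exact: cvg_cst.
- have /cvg_at_rightP := powR_cvg0 x0.
  by apply; split; [move=> n; exact: inv_natS_gt0|exact: cvg_harmonic].
Qed.

(** The limit of [gamma_trunc_rec], whose boundary terms vanish. Finiteness at [x] yields finiteness
    at [x + 1], which allows induction. *)
Lemma gamma_integral_rec (x : R) : 0 < x -> (gamma_integral x < +oo)%E ->
  gamma_integral (x + 1) = (x * Gamma x)%:E.
Proof.
move=> x0 goo.
have gfin : gamma_integral x \is a fin_num.
  rewrite ge0_fin_numE//; apply: integral_ge0 => s _.
  by rewrite lee_fin gamma_density_ge0.
apply: gamma_integral_cvg.
under eq_fun do rewrite gamma_trunc_rec//.
have -> : x * Gamma x = x * Gamma x - (0 - 0) by rewrite !subr0.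
apply: cvgB; last first.
  by apply: cvgB; [exact: cvg_powR_expRN|exact: cvg_powR_harmonic].
apply: cvgM; first exact: cvg_cst.
have := @cvg_gamma_trunc x; rewrite -(fineK gfin) => /fine_cvgP[_].
exact.
Qed.

(* On [0 < x <= 1] the density is dominated by the derivative of the bounded
   function [(s^x - (2 + s)) e^-s / x], because [s^x <= 1 + s]. *)
Lemma gamma_integral_fin (x : R) : 0 < x <= 1 -> (gamma_integral x < +oo)%E.
Proof.
move=> /andP[x0 x1].
pose F (s : R) : R := (s `^ x * expR (- s) - (2 + s) * expR (- s)).
pose f (s : R) : R := (x * gamma_density x s - gamma_density (x + 1) s)
  + (1 + s) * expR (- s).
have e1 (s : R) : 0 < s -> expR (- s) <= 1 by rewrite expR_le1; lra.
have e2 (s : R) : (1 + s) * expR (- s) <= 1.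
  by rewrite expRN ler_pdivrMr ?expR_gt0// mul1r expR_ge1Dx.
have px (s : R) : 0 < s -> s `^ x <= 1 + s.
  by move=> s0; apply: powR_le1D => //; rewrite ltW.
have cf (s : R) : 0 < s -> {for s, continuous f}.
  move=> s0; apply: cvgD.
    apply: cvgB; last exact: continuous_gamma_density.
    by apply: cvgM; [exact: cvg_cst|exact: continuous_gamma_density].
  apply: cvgM; first by apply: cvgD; [exact: cvg_cst|exact: cvg_id].
  by apply: continuous_comp; [exact: opp_continuous|exact: continuous_expR].
have dF (s : R) : 0 < s -> is_derive s 1 F (f s).
  move=> s0; have ? := is_derive1_powR x s0.
  apply: is_derive_eq; rewrite /f /gamma_density addrK /GRing.scale/=.
  by ring.
have bnd n : gamma_trunc x n <= 3 / x.
  rewrite ler_pdivlMr// mulrC -RintegralZl//; last first.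
    exact: integrable_gamma_density.
  have pos (s : R) : s \in `[n.+1%:R^-1, n.+1%:R] -> 0 < s.
    by rewrite in_itv/= => /andP[+ _]; exact: lt_le_trans (inv_natS_gt0 n).
  have intf : mu.-integrable `[n.+1%:R^-1, n.+1%:R] (EFin \o f).
    apply: continuous_compact_integrable; first exact: segment_compact.
    by apply/continuous_in_subspaceT => s; rewrite inE/= => /pos; exact: cf.
  apply: (@le_trans _ _ (\int[mu]_(s in `[n.+1%:R^-1, n.+1%:R]) f s)%R).
    apply: le_Rintegral => //.
      exact: (integrableZl _ x (integrable_gamma_density x n)).
    move=> s /= /pos s0; rewrite /f -addrA lerDl addrC subr_ge0.
    by rewrite /gamma_density addrK ler_wpM2r ?expR_ge0// px.
  have cf' (s : R) : n.+1%:R^-1 <= s <= n.+1%:R -> {for s, continuous f}.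
    by move=> sn; apply/cf/pos; rewrite in_itv.
  have dF' (s : R) : n.+1%:R^-1 <= s <= n.+1%:R -> is_derive s 1 F (f s).
    by move=> sn; apply/dF/pos; rewrite in_itv.
  rewrite (is_derive_RFTC2 (inv_natS_le n) cf' dF').
  (* The increment of [F] is bounded: [F b <= 0] because [b ^ x <= 1 + b], and [- F a <= 2] because
     [(1 + a) e^-a] and [e^-a] are at most 1. *)
  rewrite /F; set b := n.+1%:R; set a := b^-1.
  have a0 : 0 < a by exact: inv_natS_gt0.
  have b0 : 0 < b :> R by rewrite /b ltr0n.
  have h1 : b `^ x * expR (- b) <= (1 + b) * expR (- b).
    by rewrite ler_wpM2r ?expR_ge0// px.
  have h2 : 0 <= a `^ x * expR (- a) by rewrite mulr_ge0 ?powR_ge0 ?expR_ge0.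
  have := e2 a; have := e1 a a0; have := expR_ge0 (- b).
  lra.
apply: (@le_lt_trans _ _ (3 / x)%:E); last exact: ltry.
have /cvg_lim <- // := @cvg_gamma_trunc x.
apply: lime_le; first exact/cvgP/cvg_gamma_trunc.
by apply: nearW => n; rewrite lee_fin.
Qed.

(** The range []0, 1]] is the one where finiteness has been established; it covers the fractional
    orders [d]. *)
Lemma GammaS (x : R) : 0 < x <= 1 -> Gamma (x + 1) = x * Gamma x.
Proof.
move=> x01; have x0 : 0 < x by case/andP: x01.
by rewrite GammaE (gamma_integral_rec x0 (gamma_integral_fin x01)).
Qed.

Lemma Gamma_ge0 (x : R) : 0 <= Gamma x.
Proof.
by apply: fine_ge0; apply: integral_ge0 => s _; rewrite lee_fin gamma_density_ge0.
Qed.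

Lemma gamma_integral1 : gamma_integral 1 = 1%:E.
Proof.
apply: gamma_integral_cvg.
have -> : gamma_trunc 1 = (fun n => expR (- n.+1%:R^-1) - expR (- n.+1%:R)).
  apply/funext => n.
  pose F (s : R) := - expR (- s).
  transitivity (F n.+1%:R - F n.+1%:R^-1); last by rewrite /F opprK addrC.
  apply: is_derive_RFTC2.
  - exact: inv_natS_le.
  - move=> s /andP[ns _]; apply: continuous_gamma_density.
    exact: lt_le_trans (inv_natS_gt0 n) ns.
  - move=> s _; rewrite /gamma_density subrr powRr0 mul1r.
    by apply: is_derive_eq; rewrite /GRing.scale/=; ring.
suff : expR (- n.+1%:R^-1) - expR (- n.+1%:R) @[n --> \oo]
    --> expR (- 0) - (0 : R) by rewrite subr0 oppr0 expR0.
apply: cvgB.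
  have ce : {for (0 : R), continuous (fun s : R => expR (- s))}.
    by apply: continuous_comp; [exact: opp_continuous|exact: continuous_expR].
  by apply: (continuous_cvg _ ce); exact: cvg_harmonic.
have := @cvg_powR_expRN 0.
by under eq_fun do rewrite powRr0 mul1r.
Qed.

Lemma Gamma1 : Gamma (1 : R) = 1.
Proof. by rewrite GammaE gamma_integral1. Qed.

Lemma Gamma_nat (n : nat) : Gamma (n%:R + 1 : R) = n`!%:R.
Proof.
(* The induction is on the extended integral, so that each step hands finiteness to the next. *)
suff /(congr1 fine) : gamma_integral (n%:R + 1) = (n`!%:R)%:E by [].
elim: n => [|n ih]; first by rewrite add0r gamma_integral1.
rewrite -natr1 gamma_integral_rec ?ih ?ltry// ?ltr_pwDr//.
by rewrite GammaE ih factS natrM -natr1.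
Qed.

End gamma_function.

(** * The Riemann-Liouville integral *)

Section riemann_liouville.
Variables (R : realType) (d : R).
Hypothesis d01 : 0 < d < 1.
Notation mu := (@lebesgue_measure R).

Let d0 : 0 < d. Proof. by case/andP: d01. Qed.

Definition rl_kernel (t s : R) : R := (t - s) `^ (d - 1).

Lemma rl_kernel_ge0 t s : 0 <= rl_kernel t s.
Proof. exact: powR_ge0. Qed.

Lemma measurable_rl_kernel t : measurable_fun setT (rl_kernel t).
Proof.
apply: (measurableT_comp (measurable_powR _)).
exact: measurable_funB.
Qed.

Lemma is_derive_rl_kernel (t s : R) : s < t ->
  is_derive s 1 (fun s : R => - ((t - s) `^ d / d)) (rl_kernel t s).
Proof.
move=> st; have ts0 : 0 < t - s by rewrite subr_gt0.
have dp := is_derive1_powR d ts0.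
have dt : is_derive s 1 (fun s : R => t - s) (- 1).
  by apply: is_derive_eq; rewrite /GRing.scale/=; ring.
have ? : is_derive s 1 (fun s : R => (t - s) `^ d) _ :=
  is_derive1_comp (f := @powR R ^~ d) (g := fun s : R => t - s) dp dt.
apply: is_derive_eq; rewrite /GRing.scale/= /rl_kernel; field.
by rewrite gt_eqF.
Qed.

Lemma integral_rl_kernel_lt a b t : a <= b -> b < t ->
  (\int[mu]_(s in `[a, b]) (rl_kernel t s)%:E =
    (((t - a) `^ d - (t - b) `^ d) / d)%:E)%E.
Proof.
move=> ab bt; pose F (s : R) := - ((t - s) `^ d / d).
rewrite (_ : (_ - _) / d = F b - F a); last by rewrite /F; ring.
apply: is_derive_FTC2 => // s /andP[_ sb].
- have st := le_lt_trans sb bt.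
  apply: (@continuous_comp R R R (fun s => t - s) (@powR R ^~ (d - 1))).
    by apply: cvgB; [exact: cvg_cst|exact: cvg_id].
  by apply: continuous_powR_pt; rewrite subr_gt0.
- exact/is_derive_rl_kernel/(le_lt_trans sb).
Qed.

(** The kernel is unbounded near [s = t], so the interval is exhausted by the segments
    [[a, t - u n]] and monotone convergence applies; [u n ^ d] tends to 0 because [d > 0]. *)
Lemma integral_rl_kernel a t : a <= t ->
  (\int[mu]_(s in `[a, t]) (rl_kernel t s)%:E = ((t - a) `^ d / d)%:E)%E.
Proof.
rewrite le_eqVlt => /predU1P[->|at_].
  by rewrite set_itv1 integral_set1 subrr powR0 ?gt_eqF// mul0r.
have mk : measurable_fun setT (EFin \o rl_kernel t).
  by apply/measurable_EFinP; exact: measurable_rl_kernel.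
rewrite -integral_itv_bndo_bndc; last exact: measurable_funTS.
pose u n : R := (t - a) / n.+1%:R.
have u0 n : 0 < u n by rewrite divr_gt0// subr_gt0.
have cu : u n @[n --> \oo] --> (0 : R).
  rewrite -(mulr0 (t - a)); apply: cvgM; first exact: cvg_cst.
  exact: cvg_harmonic.
have au n : a <= t - u n.
  rewrite lerBrDr -lerBrDl /u ler_pdivrMr// ler_peMr ?ler1n//.
  by rewrite subr_ge0 ltW.
have nn : nondecreasing_seq (fun n => `[a, t - u n]%classic).
  apply/nondecreasing_seqP => n; rewrite subsetEset; apply: subset_itvl.
  rewrite bnd_simp lerD2l lerN2 /u ler_wpM2l ?subr_ge0 ?(ltW at_)//.
  by rewrite lef_pV2 ?posrE// ler_nat.
have -> : `[a, t[%classic = \bigcup_n `[a, t - u n]%classic.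
  apply/seteqP; split => s /=; rewrite ?in_itv/=.
    move=> /andP[as_ st].
    have ts0 : 0 < t - s by rewrite subr_gt0.
    exists (Num.Def.truncn ((t - a) / (t - s))) => //=.
    rewrite in_itv/= as_/= lerBrDr -lerBrDl /u ler_pdivrMr// mulrC.
    by rewrite -ler_pdivrMr// ltW// truncnS_gt.
  move=> [n _] /=; rewrite in_itv/= => /andP[-> /=] /le_lt_trans; apply.
  by rewrite gtrBl.
have cvgI : (\int[mu]_(s in `[a, (t - u n)%R]) (rl_kernel t s)%:E)%E
    @[n --> \oo] --> (\int[mu]_(s in \bigcup_n `[a, (t - u n)%R]%classic)
                        (rl_kernel t s)%:E)%E.
  apply: ge0_nondecreasing_set_cvg_integral => //.
  - by move=> n; exact: measurable_funTS.
  - by move=> n s _; rewrite lee_fin rl_kernel_ge0.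
have cvgR : ((((t - a) `^ d - u n `^ d) / d)%:E)%E @[n --> \oo] -->
    ((t - a) `^ d / d)%:E.
  apply: cvg_EFin; first exact: nearW.
  suff : ((t - a) `^ d - u n `^ d) / d @[n --> \oo] -->
      ((t - a) `^ d - 0) / d by rewrite subr0.
  apply: cvgM; last exact: cvg_cst.
  apply: cvgB; first exact: cvg_cst.
  by have /cvg_at_rightP := powR_cvg0 d0; apply; split.
move/cvg_lim : cvgI => <- //; apply/cvg_lim => //.
apply: cvg_trans cvgR; apply: near_eq_cvg; apply: nearW => n.
rewrite integral_rl_kernel_lt//; last by rewrite gtrBl.
by rewrite subKr.
Qed.

Section kernel_integrals.
Variables (t : R) (D : set (measurableTypeR R)).
Hypotheses (mD : measurable D) (Dt : D `<=` `[0, t]) (t0 : 0 <= t).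

Lemma integrable_rl_kernel : mu.-integrable D (EFin \o rl_kernel t).
Proof.
suff H : mu.-integrable `[0, t] (EFin \o rl_kernel t) by exact: integrableS H.
apply/integrableP; split.
  apply/measurable_EFinP; apply: measurable_funTS.
  exact: measurable_rl_kernel.
under eq_integral => s _ do rewrite /= ger0_norm ?rl_kernel_ge0//.
by rewrite integral_rl_kernel// ltry.
Qed.

Lemma integrable_rl_kernelM (w : R -> R) (B : R) : measurable_fun setT w ->
  (forall s, D s -> `|w s| <= B) ->
  mu.-integrable D (EFin \o (fun s => rl_kernel t s * w s)).
Proof.
move=> mw wB.
apply: (le_integrable mD _ _ (integrableZl mD B integrable_rl_kernel)).
  apply/measurable_EFinP; apply: measurable_funTS.
  by apply: measurable_funM => //; exact: measurable_rl_kernel.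
move=> s Ds /=; rewrite lee_fin !normrM mulrC ler_wpM2r//.
by rewrite (le_trans (wB s Ds))// ler_norm.
Qed.

Lemma le_Rintegral_rl_kernelM (w : R -> R) (B : R) : measurable_fun setT w ->
  (forall s, D s -> `|w s| <= B) ->
  `|\int[mu]_(s in D) (rl_kernel t s * w s)| <=
    B * \int[mu]_(s in D) rl_kernel t s.
Proof.
move=> mw wB; have iw := integrable_rl_kernelM mw wB.
rewrite (le_trans (le_normr_Rintegral mD iw))//.
rewrite -RintegralZl//; last exact: integrable_rl_kernel.
apply: le_Rintegral => //.
- exact: (integrable_norm iw).
- exact: (integrableZl mD B integrable_rl_kernel).
- move=> s Ds; rewrite normrM ger0_norm ?rl_kernel_ge0// mulrC.
  by rewrite ler_wpM2r ?rl_kernel_ge0// wB.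
Qed.

End kernel_integrals.

(** The exponent [d - 1] is negative. Strictness of [s < t] matters: at [s = t] the convention for
    [powR] gives the kernel the value 0. *)
Lemma rl_kernel_le t t' s : t <= t' -> s < t -> rl_kernel t' s <= rl_kernel t s.
Proof.
move=> tt' st; rewrite /rl_kernel -[d - 1]opprB !powRN.
have ? : 0 < t - s by rewrite subr_gt0.
have ? : 0 < t' - s by rewrite subr_gt0 (lt_le_trans st).
rewrite lef_pV2 ?posrE ?powR_gt0//; apply: ge0_ler_powR.
- by case/andP: d01 => _ /ltW; rewrite subr_ge0.
- by rewrite nnegrE ltW.
- by rewrite nnegrE ltW.
- by rewrite lerD2r.
Qed.

(** Cut [[0, t']] at [t]. The piece beyond [t] is at most [B / d * (t' - t) ^ d]. Before [t] the
    difference of the kernels has constant sign, so its integral is explicit,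
    [(t ^ d - t' ^ d + (t' - t) ^ d) / d], and [B] times it obeys the same bound. *)
Lemma rl_integral_hoelder (w : R -> R) (B t t' : R) : measurable_fun setT w ->
  (forall s, `|w s| <= B) -> 0 <= t -> t <= t' ->
  `|\int[mu]_(s in `[0, t']) (rl_kernel t' s * w s) -
    \int[mu]_(s in `[0, t]) (rl_kernel t s * w s)| <=
  2 * B / d * (t' - t) `^ d.
Proof.
move=> mw wB t0; rewrite le_eqVlt => /predU1P[<-|tt'].
  by rewrite !subrr normr0 powR0 ?mulr0// gt_eqF.
have t'0 : 0 <= t' by rewrite (le_trans t0)// ltW.
have B0 : 0 <= B by rewrite (le_trans _ (wB 0)).
have sub1 : `[0, t[ `<=` `[0, t] by exact: subset_itv_co_cc.
have sub2 : `[0, t[ `<=` `[0, t'].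
  by apply: subset_itvl; rewrite bnd_simp ltW.
have sub3 : `]t, t'] `<=` `[0, t'] by apply: subset_itvr; rewrite bnd_simp.
have mi (i : interval R) : measurable ([set` i] : set (measurableTypeR R)).
  exact: measurable_itv.
have i1 := integrable_rl_kernelM (mi _) sub1 t0 mw (fun s _ => wB s).
have i2 := integrable_rl_kernelM (mi _) sub2 t'0 mw (fun s _ => wB s).
have i3 := integrable_rl_kernelM (mi _) (@subset_refl _ _) t'0 mw (fun s _ => wB s).
have k1 := integrable_rl_kernel (mi _) sub1 t0.
have k2 := integrable_rl_kernel (mi _) sub2 t'0.
have split_t' := Rintegral_itvB i3 (_ : (BLeft 0 <= BRight t)%O) (_ : (BRight t <= BRight t')%O).
have := split_t' ltac:(by rewrite bnd_simp) ltac:(by rewrite bnd_simp ltW).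
move/eqP; rewrite subr_eq => /eqP ->.
rewrite -(Rintegral_itv_bndo_bndc i1) -(Rintegral_itv_bndo_bndc i2).
rewrite -addrA -RintegralB//.
rewrite (le_trans (ler_normD _ _))//.
have tail : `|\int[mu]_(s in `]t, t']) (rl_kernel t' s * w s)| <=
    B / d * (t' - t) `^ d.
  rewrite (le_trans (le_Rintegral_rl_kernelM (mi _) sub3 t'0 mw (fun s _ => wB s)))//.
  rewrite Rintegral_itv_obnd_cbnd; last exact: integrable_rl_kernel.
  by rewrite /Rintegral integral_rl_kernel ?(ltW tt')//= mulrA mulrAC.
have head : `|\int[mu]_(s in `[0, t[)
      (rl_kernel t' s * w s - rl_kernel t s * w s)| <= B / d * (t' - t) `^ d.
  have ii := integrableB (mi _) i2 i1.
  rewrite (le_trans (le_normr_Rintegral (mi _) ii))//.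
  apply: (@le_trans _ _
    (\int[mu]_(s in `[0, t[) (B * (rl_kernel t s - rl_kernel t' s)))).
    apply: le_Rintegral => //.
    - exact: (integrable_norm ii).
    - exact: (integrableZl (mi _) B (integrableB (mi _) k1 k2)).
    - move=> s /=; rewrite in_itv/= => /andP[_ st].
      have kk : 0 <= rl_kernel t s - rl_kernel t' s.
        by rewrite subr_ge0 rl_kernel_le// ltW.
      rewrite /= -mulrBl normrM (distrC (rl_kernel t' s)) (ger0_norm kk) mulrC.
      by rewrite ler_wpM2r.
  rewrite RintegralZl//; last exact: (integrableB (mi _) k1 k2).
  rewrite RintegralB// !Rintegral_itv_bndo_bndc// /Rintegral.
  rewrite integral_rl_kernel// integral_rl_kernel_lt//= !subr0.
  rewrite -mulrBl -mulrA ler_wpM2l// mulrC ler_wpM2l ?invr_ge0 ?(ltW d0)//.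
  have : t `^ d <= t' `^ d.
    by apply: ge0_ler_powR; rewrite ?nnegrE// ltW.
  lra.
rewrite (le_trans (lerD tail head))//.
by rewrite [leRHS](_ : _ = B / d * (t' - t) `^ d + B / d * (t' - t) `^ d)//; ring.
Qed.

Lemma RLintE (w : R -> R) t :
  RLint d w t = (Gamma d)^-1 * \int[mu]_(s in `[0, t]) (rl_kernel t s * w s).
Proof. by rewrite /RLint gt_eqF. Qed.

End riemann_liouville.

Lemma hoelder_continuous (R : realType) (d C : R) (v : R -> R) : 0 < d ->
  (forall s t, `|v s - v t| <= C * `|s - t| `^ d) -> continuous v.
Proof.
move=> d0 vC t; apply/cvgrPdist_le => e e0.
(* The constant [|C| + 1] is positive whatever [C] is, and [r] solves [(|C| + 1) * r ^ d = e]. *)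
have C1 : 0 < `|C| + 1 by rewrite ltr_wpDl.
pose r := (e / (`|C| + 1)) `^ d^-1.
have r0 : 0 < r by rewrite powR_gt0// divr_gt0.
near=> s.
have str : `|t - s| <= r.
  by near: s; apply: cvgr_dist_le => //; exact: cvg_id.
rewrite (le_trans (vC _ _))//.
have : `|t - s| `^ d <= e / (`|C| + 1).
  rewrite (@le_trans _ _ (r `^ d))//.
    by apply: ge0_ler_powR; rewrite ?nnegrE// ltW.
  by rewrite /r -powRrM mulVf ?gt_eqF// powRr1// ltW// divr_gt0.
rewrite ler_pdivlMr// mulrC => /(le_trans _); apply.
rewrite ler_wpM2r ?powR_ge0// (le_trans (ler_norm _))// lerDl//.
Unshelve. all: by end_near.
Qed.

(** * [J^d] on bounded continuous functions, with [d = 0] included *)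

Section riemann_liouville_operator.
Variables (R : realType) (d : R).
Hypothesis d01 : 0 <= d < 1.
Implicit Types v w : R -> R.

Lemma eq_RLint v w t : 0 <= t -> (forall s, 0 <= s <= t -> v s = w s) ->
  RLint d v t = RLint d w t.
Proof.
move=> t0 vw; rewrite /RLint; case: ifPn => _; first by rewrite vw// t0 lexx.
congr (_ * fine _); apply: eq_integral => s; rewrite inE/= in_itv/= => st.
by rewrite vw.
Qed.

Lemma RLintB v w B t : continuous v -> continuous w ->
  (forall s, `|v s| <= B) -> (forall s, `|w s| <= B) -> 0 <= t ->
  RLint d (fun s => v s - w s) t = RLint d v t - RLint d w t.
Proof.
move=> cv cw vB wB t0.
have [d_0|d_neq0] := eqVneq d 0; first by rewrite /RLint d_0 eqxx.
have d01' : 0 < d < 1.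
  by case/andP: d01 => d0 ->; rewrite lt_neqAle eq_sym d_neq0 d0.
have mv : measurable_fun setT v by exact: continuous_measurable_fun.
have mw : measurable_fun setT w by exact: continuous_measurable_fun.
rewrite !(RLintE d01') -mulrBr -RintegralB//.
- by congr (_ * _); apply: eq_Rintegral => s _; rewrite mulrBr.
- exact: (integrable_rl_kernelM d01' (measurable_itv _) _ _ mv (fun s _ => vB s)).
- exact: (integrable_rl_kernelM d01' (measurable_itv _) _ _ mw (fun s _ => wB s)).
Qed.

(** For [t >= 0], [J^d] of the constant 1 is [t ^ d / Gamma (d + 1)], by [GammaS]; with [a = I] this
    is the factor that appears in [G]. *)
Lemma RLint_bound w B t a : continuous w -> 0 <= t <= a ->
  (forall s, 0 <= s <= t -> `|w s| <= B) ->
  `|RLint d w t| <= a `^ d / Gamma (d + 1) * B.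
Proof.
move=> cw /andP[t0 ta] wB.
have B0 : 0 <= B by rewrite (le_trans _ (wB 0 _))// lexx.
have [d_0|d_neq0] := eqVneq d 0.
  rewrite d_0 /RLint eqxx powRr0 add0r Gamma1 divr1 mul1r.
  by rewrite wB// t0 lexx.
have d01' : 0 < d < 1.
  by case/andP: d01 => d0 ->; rewrite lt_neqAle eq_sym d_neq0 d0.
have d0 : 0 < d by case/andP: d01'.
have mw : measurable_fun setT w by exact: continuous_measurable_fun.
rewrite (RLintE d01') normrM ger0_norm ?invr_ge0 ?Gamma_ge0//.
rewrite GammaS; last by case/andP: d01' => -> /ltW ->.
have := le_Rintegral_rl_kernelM d01' (measurable_itv _) (@subset_refl _ _) t0 mw.
move=> /(_ B); rewrite {2}/Rintegral integral_rl_kernel//= subr0 => H.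
have {}H : `|\int[lebesgue_measure]_(s in `[0, t]) (rl_kernel d t s * w s)|
    <= B * (t `^ d / d).
  by apply: H => s; rewrite /= in_itv/=; exact: wB.
rewrite (le_trans (ler_wpM2l _ H)) ?invr_ge0 ?Gamma_ge0//.
have -> : a `^ d / (d * Gamma d) * B = (Gamma d)^-1 * (B * (a `^ d / d)).
  by rewrite invfM; ring.
rewrite ler_wpM2l ?invr_ge0 ?Gamma_ge0// ler_wpM2l//.
rewrite ler_wpM2r ?invr_ge0 ?(ltW d0)//.
apply: ge0_ler_powR; rewrite ?nnegrE ?(ltW d0)//.
exact: le_trans ta.
Qed.

(** For [d > 0] the function is Hölder of exponent [d] on the half-line by [rl_integral_hoelder],
    and on the whole line because the integral over [[0, t]] vanishes for [t <= 0]. *)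
Lemma continuous_RLint w B : continuous w -> (forall s, `|w s| <= B) ->
  continuous (RLint d w).
Proof.
move=> cw wB; have [d_0|d_neq0] := eqVneq d 0.
  suff -> : RLint d w = w by [].
  by apply/funext => t; rewrite /RLint d_0 eqxx.
have d01' : 0 < d < 1.
  by case/andP: d01 => d0 ->; rewrite lt_neqAle eq_sym d_neq0 d0.
have d0 : 0 < d by case/andP: d01'.
have mw : measurable_fun setT w by exact: continuous_measurable_fun.
have B0 : 0 <= B by rewrite (le_trans _ (wB 0)).
have RL0 t : t <= 0 -> RLint d w t = RLint d w 0.
  rewrite le_eqVlt => /predU1P[->//|t0]; rewrite !(RLintE d01'); congr (_ * _).
  by rewrite set_itv1 Rintegral_set1 set_itv_ge ?Rintegral_set0// bnd_simp -ltNge.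
have RLp s t : 0 <= s -> s <= t ->
    `|RLint d w t - RLint d w s| <= (Gamma d)^-1 * (2 * B / d) * (t - s) `^ d.
  move=> s0 st; rewrite !(RLintE d01') -mulrBr normrM.
  rewrite ger0_norm ?invr_ge0 ?Gamma_ge0// -mulrA.
  by rewrite ler_wpM2l ?invr_ge0 ?Gamma_ge0// (rl_integral_hoelder d01').
set C := _ * (2 * B / d) in RLp.
have C0 : 0 <= C.
  by rewrite !mulr_ge0 ?invr_ge0 ?Gamma_ge0// ltW.
have RLs s t : s <= t -> `|RLint d w t - RLint d w s| <= C * (t - s) `^ d.
  move=> st; have [s0|s0] := leP 0 s; first exact: RLp.
  have [t0|t0] := leP t 0.
    by rewrite !RL0// ?(ltW s0)// subrr normr0 mulr_ge0 ?powR_ge0.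
  rewrite (RL0 s (ltW s0)) (le_trans (RLp 0 t _ (ltW t0)))//.
  rewrite ler_wpM2l//; apply: ge0_ler_powR; rewrite ?nnegrE ?(ltW d0)//; lra.
apply: (@hoelder_continuous _ d C) => // s t.
have [st|/ltW st] := leP s t.
  by rewrite distrC [`|s - t|]distrC [`|t - s|]ger0_norm ?subr_ge0 ?RLs.
by rewrite [`|s - t|]ger0_norm ?subr_ge0 ?RLs.
Qed.

End riemann_liouville_operator.

(** * Iterated primitives *)

Section primitives.
Variable R : realType.
Notation mu := (@lebesgue_measure R).
Implicit Types (g q : R -> R) (c : R).

Lemma continuous_integrable_itv g (a b : R) : continuous g ->
  mu.-integrable `[a, b] (EFin \o g).
Proof.
move=> cg; apply: continuous_compact_integrable; first exact: segment_compact.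
exact: continuous_subspaceT.
Qed.

(** For [t <= 0] the integral vanishes: with [g] continuous this is continuous on the line, but an
    antiderivative of [g] only from 0 on. *)
Definition primitive c g (t : R) : R := c + \int[mu]_(s in `[0, t]) g s.

Lemma primitive_le0 c g t : t <= 0 -> primitive c g t = c.
Proof.
rewrite /primitive le_eqVlt => /predU1P[->|t0].
  by rewrite set_itv1 Rintegral_set1 addr0.
by rewrite set_itv_ge ?Rintegral_set0 ?addr0// bnd_simp -ltNge.
Qed.

Lemma eq_primitive c g g' t : (forall s, 0 <= s <= t -> g s = g' s) ->
  primitive c g t = primitive c g' t.
Proof.
move=> gg'; congr (_ + _); apply: eq_Rintegral => s.
by rewrite inE/= in_itv/=; exact: gg'.
Qed.

(** Integrate [|g - l| <= e] over []a, b]]. Taking [l = g t] gives differentiability, and [l = 0]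
    the Lipschitz bound. *)
Lemma primitive_close c g a b l e : continuous g -> 0 <= a -> a <= b ->
  (forall s, a <= s <= b -> `|g s - l| <= e) ->
  `|primitive c g b - primitive c g a - l * (b - a)| <= e * (b - a).
Proof.
move=> cg a0 ab gl.
have int0 := continuous_integrable_itv 0 b cg.
have mab : fine (mu `]a, b]) = b - a.
  rewrite lebesgue_measure_itv/= lte_fin.
  by case: ltP => //= ba; lra.
have sub : `]a, b] `<=` `[0, b] by apply: subset_itvr; rewrite bnd_simp.
have iab : mu.-integrable `]a, b] (EFin \o g) by apply: integrableS int0.
have ic (r : R) : mu.-integrable `]a, b] (EFin \o (fun=> r)).
  suff : mu.-integrable `[0, b] (EFin \o (fun=> r)) by apply: integrableS.
  by apply: continuous_integrable_itv => x; exact: cvg_cst.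
have -> : primitive c g b - primitive c g a = \int[mu]_(s in `]a, b]) g s.
  rewrite /primitive opprD addrACA subrr add0r (Rintegral_itvB int0)//.
rewrite -mab -Rintegral_cst// -RintegralB//.
have igl : mu.-integrable `]a, b] (EFin \o (fun s => g s - l)).
  exact: (integrableB _ iab (ic l)).
rewrite (le_trans (le_normr_Rintegral _ igl))// -Rintegral_cst//.
apply: le_Rintegral => //; first exact: (integrable_norm igl).
by move=> s /=; rewrite in_itv/= => /andP[/ltW as_ sb]; apply: gl; rewrite as_.
Qed.

Lemma primitive_local c g t e : continuous g -> 0 <= t -> 0 < e ->
  exists2 r, 0 < r & forall s, 0 <= s -> `|s - t| < r ->
    `|primitive c g s - primitive c g t - g t * (s - t)| <= e * `|s - t|.
Proof.
move=> cg t0 e0.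
have /cvgrPdist_le /(_ e e0) := cg t.
move=> /nbhs_ballP[r /= r0 gr]; exists r => // s s0 str.
have gb x : `|x - t| <= `|s - t| -> `|g x - g t| <= e.
  move=> xs; rewrite distrC; apply: gr; rewrite /ball/= distrC.
  exact: le_lt_trans str.
have [st|/ltW ts] := leP s t.
  have {}gb x : s <= x <= t -> `|g x - g t| <= e.
    by move=> /andP[sx xt]; apply: gb; rewrite !ler0_norm; lra.
  have := primitive_close c cg s0 st gb.
  by rewrite -normrN [`|s - t|]distrC [`|t - s|]ger0_norm ?subr_ge0//;
    congr (`|_| <= _); ring.
have {}gb x : t <= x <= s -> `|g x - g t| <= e.
  by move=> /andP[sx xt]; apply: gb; rewrite !ger0_norm; lra.
have := primitive_close c cg t0 ts gb.
by rewrite [`|s - t|]ger0_norm ?subr_ge0.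
Qed.

Lemma continuous_primitive c g : continuous g -> continuous (primitive c g).
Proof.
move=> cg t.
(* The primitive factors through the projection [p] onto the half-line, where [primitive_local]
   applies. *)
pose p (x : R) : R := Num.max 0 x.
have p0 x : 0 <= p x by rewrite /p le_max lexx.
have pE x : primitive c g x = primitive c g (p x).
  by rewrite /p maxEle; case: ifPn => //; rewrite -ltNge => /ltW /primitive_le0 ->;
    rewrite primitive_le0.
have plip s : `|p s - p t| <= `|s - t|.
  have := ler_norm (s - t); have := ler_norm (t - s); rewrite (distrC t) => *.
  rewrite ler_norml /p !maxEle.
  by apply/andP; split; do 2 case: ifPn; rewrite -?ltNge => *; lra.
have [r r0 gr] := primitive_local c cg (p0 t) (@ltr01 R).
apply/cvgrPdist_le => e e0.
pose C := `|g (p t)| + 1.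
have C0 : 0 < C by rewrite ltr_wpDl.
near=> s.
have str : `|s - t| < r.
  by rewrite distrC; near: s; apply: cvgr_dist_lt => //; exact: cvg_id.
have ste : `|s - t| <= e / C.
  rewrite distrC; near: s; apply: cvgr_dist_le; first exact: cvg_id.
  by rewrite divr_gt0.
rewrite distrC (pE s) (pE t).
have := gr _ (p0 s) (le_lt_trans (plip s) str).
set A := primitive c g (p s) - primitive c g (p t).
set B := g _ * _ => AB.
have : `|A| <= C * `|p s - p t|.
  have -> : A = A - B + B by ring.
  rewrite (le_trans (ler_normD _ _))// /C mulrDl addrC lerD//.
  by rewrite normrM.
move=> /le_trans; apply.
rewrite mulrC -ler_pdivlMr//; exact: le_trans (plip s) ste.
Unshelve. all: by end_near.
Qed.

Lemma is_derive_within_primitive c g h t : continuous g -> 0 <= t ->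
  is_derive_within `[0, h] (primitive c g) t (g t).
Proof.
move=> cg t0; apply/cvgrPdist_le => e e0.
have [r r0 gr] := primitive_local c cg t0 e0.
suff : nbhs t [set s | s != t -> `[0, h]%classic s ->
    `|g t - (primitive c g s - primitive c g t) / (s - t)| <= e] by [].
apply/nbhs_ballP; exists r => //= s str st; rewrite in_itv/= => /andP[s0 _].
have st0 : s - t != 0 by rewrite subr_eq0.
have st1 : 0 < `|s - t| by rewrite normr_gt0.
move: str; rewrite /ball/= distrC => str.
rewrite -(ler_pM2r st1) -normrM mulrBl divfK// distrC.
exact: gr.
Qed.

Lemma primitive_bound c g q t : continuous g -> continuous q -> 0 <= t ->
  (forall s, 0 <= s <= t -> `|g s| <= q s) ->
  `|primitive c g t| <= `|c| + \int[mu]_(s in `[0, t]) q s.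
Proof.
move=> cg cq t0 gq; have ig := continuous_integrable_itv 0 t cg.
rewrite (le_trans (ler_normD _ _))// lerD2l.
rewrite (le_trans (le_normr_Rintegral _ ig))//.
apply: le_Rintegral => //; first exact: (integrable_norm ig).
exact: continuous_integrable_itv.
Qed.

Lemma primitive_lipschitz c g C a b : continuous g -> 0 <= a -> a <= b ->
  (forall s, a <= s <= b -> `|g s| <= C) ->
  `|primitive c g b - primitive c g a| <= C * (b - a).
Proof.
move=> cg a0 ab gC; have := @primitive_close c g a b 0 C cg a0 ab.
by rewrite mul0r subr0; apply => s sab; rewrite subr0 gC.
Qed.

Lemma primitive_dist c g g' t e : continuous g -> continuous g' -> 0 <= t ->
  (forall s, 0 <= s <= t -> `|g s - g' s| <= e) ->
  `|primitive c g t - primitive c g' t| <= e * t.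
Proof.
move=> cg cg' t0 gg'.
have cgg' : continuous (fun s => g s - g' s).
  by move=> s; apply: cvgB; [exact: cg|exact: cg'].
have := @primitive_lipschitz 0 _ e 0 t cgg' (lexx 0) t0 gg'.
rewrite [primitive _ _ 0]primitive_le0// /primitive add0r !subr0.
rewrite RintegralB//; [|exact: continuous_integrable_itv..].
by rewrite opprD addrACA subrr add0r.
Qed.

(** The constant [c j] is the initial value of the [j.+1]-fold primitive, so [c] lists initial
    values from the highest derivative downwards. *)
Fixpoint iter_primitive (c : nat -> R) g (i : nat) : R -> R :=
  if i is j.+1 then primitive (c j) (iter_primitive c g j) else g.

Section iter_primitive.
Variable c : nat -> R.

Lemma continuous_iter_primitive g i : continuous g ->
  continuous (iter_primitive c g i).
Proof. by move=> cg; elim: i => //= i; exact: continuous_primitive. Qed.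

Lemma eq_iter_primitive g g' i t : (forall s, 0 <= s <= t -> g s = g' s) ->
  0 <= t -> iter_primitive c g i t = iter_primitive c g' i t.
Proof.
elim: i t => [|i ih] t gg' t0; first by rewrite /= gg'// t0 lexx.
apply: eq_primitive => s /andP[s0 st]; apply: ih => // r /andP[r0 rs].
by rewrite gg'// r0 (le_trans rs).
Qed.

(** The constants [c] cancel in the difference, and each integration costs at most a factor [t]. *)
Lemma iter_primitive_dist g g' i t e : continuous g -> continuous g' ->
  (forall s, 0 <= s <= t -> `|g s - g' s| <= e) -> 0 <= t ->
  `|iter_primitive c g i t - iter_primitive c g' i t| <= e * t ^+ i.
Proof.
move=> cg cg'; elim: i t => [|i ih] t gg' t0.
  by rewrite expr0 mulr1 gg'// t0 lexx.
have e0 : 0 <= e by rewrite (le_trans _ (gg' 0 _))// lexx.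
rewrite exprSr mulrA; apply: primitive_dist => //.
- exact: continuous_iter_primitive.
- exact: continuous_iter_primitive.
- move=> s /andP[s0 st]; rewrite (le_trans (ih s _ _))//.
    by move=> r /andP[r0 rs]; rewrite gg'// r0 (le_trans rs).
  by rewrite ler_wpM2l// lerXn2r.
Qed.

(** The Taylor polynomial at 0 of the [i]-fold iterated primitive of the constant [M] with initial
    values [|c j|]. The index [i.-1 - j] reverses the order because [c] starts from the highest
    derivative. *)
Definition taylor_bound (M : R) (i : nat) (t : R) : R :=
  M * (t ^+ i / i`!%:R) + \sum_(j < i) t ^+ j / j`!%:R * `|c (i.-1 - j)%N|.

Lemma is_derive_expn_fact (j : nat) (t : R) :
  is_derive t 1 (fun t : R => t ^+ j.+1 / j.+1`!%:R) (t ^+ j / j`!%:R).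
Proof.
have ? : is_derive t 1 (fun t : R => t ^+ j.+1) (j.+1%:R * t ^+ j).
  by split; [exact: exprn_derivable|rewrite exp_derive /GRing.scale/= mulr1].
rewrite factS natrM; apply: is_derive_eq; rewrite /GRing.scale/=.
have ? : j`!%:R != 0 :> R by rewrite pnatr_eq0 -lt0n fact_gt0.
have ? : j.+1%:R != 0 :> R by rewrite pnatr_eq0.
by field; apply/andP.
Qed.

Lemma is_derive_taylor_bound (M : R) (i : nat) (t : R) :
  is_derive t 1 (taylor_bound M i.+1) (taylor_bound M i t).
Proof.
(* The term [j = 0] of the sum is isolated: it is constant, and the others differentiate to the sum
   for [i]. *)
have -> : taylor_bound M i.+1 = (fun t => M * (t ^+ i.+1 / i.+1`!%:R)) +
    (fun=> `|c i|) +
    \sum_(j < i) (fun t => t ^+ j.+1 / j.+1`!%:R * `|c (i.-1 - j)%N|).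
  apply/funext => x; rewrite /taylor_bound big_ord_recl /= expr0 fact0 divr1 mul1r.
  rewrite subn0 !fctE fct_sumE addrA; congr (_ + _).
  apply: eq_bigr => j _; rewrite /bump/= add1n.
  by case: i j => [[]//|i] j; rewrite subSS.
have dj (j : nat) : is_derive t 1 (fun t : R => t ^+ j.+1 / j.+1`!%:R) _ :=
  is_derive_expn_fact j t.
have d1 : is_derive t 1 (fun t : R => M * (t ^+ i.+1 / i.+1`!%:R))
    (M * (t ^+ i / i`!%:R)).
  exact: (is_deriveZ M (dj i)).
have d2 : is_derive t 1
    (\sum_(j < i) (fun t : R => t ^+ j.+1 / j.+1`!%:R * `|c (i.-1 - j)%N|))
    (\sum_(j < i) t ^+ j / j`!%:R * `|c (i.-1 - j)%N|).
  apply: is_derive_sum => j.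
  apply: (is_derive_eq (is_deriveM (dj j) (is_derive_cst _ t 1))).
  by rewrite /GRing.scale/= mulr0 add0r mulrC.
apply: (is_derive_eq (is_deriveD (is_deriveD d1 (is_derive_cst `|c i| t 1)) d2)).
by rewrite addr0.
Qed.

Lemma continuous_taylor_bound M i : continuous (taylor_bound M i).
Proof.
case: i => [|i] t.
  rewrite (_ : taylor_bound M 0 = cst (M * (1 / 1))); first exact: cvg_cst.
  by apply/funext => x; rewrite /taylor_bound big_ord0 addr0 expr0 fact0.
apply: differentiable_continuous; apply/derivable1_diffP.
by have [] := is_derive_taylor_bound M i t.
Qed.

Lemma iter_primitive_bound g M i t : continuous g ->
  (forall s, `|g s| <= M) -> 0 <= t ->
  `|iter_primitive c g i t| <= taylor_bound M i t.
Proof.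
move=> cg gM; elim: i t => [|i ih] t t0.
  by rewrite /taylor_bound big_ord0 addr0 expr0 fact0 divr1 mulr1.
have := @primitive_bound (c i) _ _ t (continuous_iter_primitive (i := i) cg)
  (continuous_taylor_bound (M := M) (i := i)) t0.
move=> /(_ _)/le_trans; apply=> [s /andP[s0 _]|]; first exact: ih.
rewrite (is_derive_RFTC2 t0 (fun x _ => @continuous_taylor_bound M i x)
  (fun x _ => is_derive_taylor_bound M i x)).
(* Integrating the bound for [i] leaves [|c i| <= taylor_bound M i.+1 0], which the term [j = 0]
   provides. *)
rewrite addrCA gerDl subr_le0 /taylor_bound big_ord_recl /= expr0 fact0 divr1.
by rewrite mul1r subn0 expr0n/= mul0r mulr0 add0r lerDl sumr_ge0.
Qed.

Lemma le_taylor_bound M i s t : 0 <= M -> 0 <= s -> s <= t ->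
  taylor_bound M i s <= taylor_bound M i t.
Proof.
move=> M0 s0 st; have t0 := le_trans s0 st.
have le j : s ^+ j / j`!%:R <= t ^+ j / j`!%:R.
  by rewrite ler_wpM2r ?invr_ge0// lerXn2r.
apply: lerD; first by rewrite ler_wpM2l.
by apply: ler_sum => j _; rewrite ler_wpM2r.
Qed.

End iter_primitive.
End primitives.

(** * The initial value problem *)

Section clamp.
Variable R : realType.
Implicit Types a b s t x : R.

Definition clamp a b x : R := Num.max a (Num.min b x).

Lemma clamp_itv a b x : a <= b -> a <= clamp a b x <= b.
Proof. by move=> ab; rewrite /clamp le_max lexx ge_max ab ge_min lexx. Qed.

Lemma clamp_id a b x : a <= x <= b -> clamp a b x = x.
Proof. by move=> /andP[ax xb]; rewrite /clamp (min_idPr xb) (max_idPr ax). Qed.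

Lemma clamp_lipschitz a b s t : `|clamp a b s - clamp a b t| <= `|s - t|.
Proof.
have := ler_norm (s - t); have := ler_norm (t - s); rewrite (distrC t) => *.
rewrite ler_norml /clamp !maxEle !minEle.
by apply/andP; split; do 4 case: ifPn; rewrite -?ltNge => *; lra.
Qed.

Lemma lipschitz_continuous (L : R) (w : R -> R) :
  (forall s t, `|w s - w t| <= L * `|s - t|) -> continuous w.
Proof.
by move=> wL; apply: (@hoelder_continuous _ 1 L) => // s t; rewrite powRr1.
Qed.

Lemma continuous_clamp a b : continuous (clamp a b).
Proof.
by apply: (@lipschitz_continuous 1) => s t; rewrite mul1r clamp_lipschitz.
Qed.

End clamp.

(** * Continuous bounded extension of [f] from a box to the plane *)

Section clamped_function.
Variables (R : realType) (f : R -> R -> R) (I V : R).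
Hypotheses (I0 : 0 <= I) (V0 : 0 <= V).
Hypothesis cf :
  {within [set p : R * R | 0 <= p.1 <= I], continuous (fun p => f p.1 p.2)}.

Let K : set (R * R) := `[0, I] `*` `[- V, V].
Let cl (p : R * R) : R * R := (clamp 0 I p.1, clamp (- V) V p.2).

Definition clamped (s v : R) : R := f (clamp 0 I s) (clamp (- V) V v).

Lemma continuous_clamped : continuous (fun p : R * R => clamped p.1 p.2).
Proof.
move=> p; have /subspace_continuousP := cf.
move=> /(_ (cl p)) H; have {}H := H (clamp_itv p.1 I0).
apply: (@cvg_comp _ _ _ cl (fun q => f q.1 q.2) _ _ _ _ H).
have ccl : cl q @[q --> p] --> cl p.
  have c1 : clamp 0 I q.1 @[q --> p] --> clamp 0 I p.1.
    apply: (@continuous_comp _ _ _ fst (clamp 0 I)); first exact: cvg_fst.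
    exact: continuous_clamp.
  have c2 : clamp (- V) V q.2 @[q --> p] --> clamp (- V) V p.2.
    apply: (@continuous_comp _ _ _ snd (clamp (- V) V)); first exact: cvg_snd.
    exact: continuous_clamp.
  exact: (cvg_pair c1 c2).
(* [f] is continuous only within the strip; clamped points always lie in it, so the restriction on
   the neighbourhood disappears. *)
move=> A /ccl Ap; suff : nbhs p [set q | A (cl q)] by [].
have {}Ap : nbhs p [set q | 0 <= (cl q).1 <= I -> A (cl q)] by exact: Ap.
by apply: filterS Ap => q; apply; exact: clamp_itv.
Qed.

Lemma compact_clamp_box : compact K.
Proof. by apply: compact_setX; exact: segment_compact. Qed.

Lemma clamp_box p : K (cl p).
Proof.
by split; rewrite /= in_itv/=; apply: clamp_itv => //; rewrite ge0_cp.
Qed.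

(** Heine's argument on the compact box, through near coverings; other points are brought back to
    the box by clamping, which is idempotent and does not increase distances. *)
Lemma clamped_unif (e : R) : 0 < e -> exists2 d, 0 < d &
  forall s v v', `|v - v'| <= d -> `|clamped s v - clamped s v'| <= e.
Proof.
move=> e0; have e20 : 0 < e / 2 by rewrite divr_gt0.
have := compact_clamp_box; rewrite compact_near_coveringP.
pose P (d : R) (p : R * R) := forall v,
  `|v - p.2| <= d -> `|clamped p.1 v - clamped p.1 p.2| <= e.
move=> /(_ R 0^'+ P).
have loc p : K p -> \forall q \near p & d \near 0^'+, P d q.
  move=> _; have /cvgrPdist_le /(_ _ e20) := @continuous_clamped p.
  move=> /nbhs_ballP[r /= r0 pr].
  (* Half of [r] is spent on the move from [p] to [q], the other half on the move from [q.2] to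
     [v]. *)
  near=> q d => v vq.
  have qp : ball p (r / 2) q.
    by near: q; apply: nbhsx_ballx; rewrite divr_gt0.
  have dr : d < r / 2 by near: d; apply: nbhs_right_lt; rewrite divr_gt0.
  have pq : ball p r q by apply: le_ball qp; lra.
  have pqv : ball p r (q.1, v).
    case: qp => qp1 qp2; split => /=.
      by apply: le_ball qp1; lra.
    have {}qp2 : `|p.2 - q.2| < r / 2 by exact: qp2.
    suff : `|p.2 - v| < r by [].
    have -> : p.2 - v = (p.2 - q.2) - (v - q.2) by lra.
    rewrite (le_lt_trans (ler_normB _ _))// (splitr r) ltrD//.
    exact: le_lt_trans vq dr.
  have h1 := pr _ pq; have h2 := pr _ pqv; rewrite /= in h1 h2.
  set A := clamped p.1 p.2 in h1 h2.
  have -> : clamped q.1 v - clamped q.1 q.2 =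
    (A - clamped q.1 q.2) - (A - clamped q.1 v) by lra.
  rewrite (le_trans (ler_normB _ _))//; lra.
move=> /(_ _ loc) H.
have : \forall d \near (0 : R)^'+, 0 < d /\ K `<=` P d.
  by near=> d; split; near: d => //; exact: nbhs_right_gt.
move=> /filter_ex[d [d0 Kd]]; exists d => // s v v' vv'.
have := Kd _ (clamp_box (s, v')) (clamp (- V) V v).
rewrite /P /clamped/= !(@clamp_id _ 0 I (clamp 0 I s)) ?clamp_itv//.
rewrite !(@clamp_id _ (- V) V (clamp (- V) V _)) ?clamp_itv ?ge0_cp//.
by apply; exact: le_trans (clamp_lipschitz _ _ _ _) vv'.
Unshelve. all: by end_near.
Qed.

(** Every value of [clamped] is a value of [f] on the box. The extreme value theorem provides the
    upper bound without which [sup] need not dominate its set. *)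
Lemma clamped_le_sup (s v : R) :
  `|clamped s v| <= sup [set `|f p.1 p.2| | p in
    [set p : R * R | 0 <= p.1 <= I /\ `|p.2| <= V]].
Proof.
have inK (p : R * R) : 0 <= p.1 <= I /\ `|p.2| <= V -> clamped p.1 p.2 = f p.1 p.2.
  by move=> [pI pV]; rewrite /clamped !clamp_id// -ler_norml.
apply: ub_le_sup.
  have [||q _ qmax] := @compact_EVT_max _ R (fun p => `|clamped p.1 p.2|) K _
    compact_clamp_box.
  - by exists (cl (0, 0)); exact: clamp_box.
  - apply: continuous_subspaceT => p; apply: cvg_norm.
    exact: continuous_clamped.
  exists `|clamped q.1 q.2| => _ [p pG <-]; rewrite -inK//.
  apply: qmax; rewrite inE; case: pG => p1 p2; split; rewrite /= in_itv//=.
  by rewrite -ler_norml.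
exists (cl (s, v)) => //=; split; first exact: clamp_itv.
by rewrite ler_norml clamp_itv// ge0_cp.
Qed.

End clamped_function.

Lemma continuous_comp_graph (R : realType) (f : R -> R -> R) (g : R -> R) :
  continuous (fun p : R * R => f p.1 p.2) -> continuous g ->
  continuous (fun s => f s (g s)).
Proof.
move=> cf cg s.
apply: (@continuous_comp _ _ _ (fun s => (s, g s)) (fun p => f p.1 p.2)).
  have c1 : x @[x --> s] --> s by exact: cvg_id.
  have c2 : g x @[x --> s] --> g s by exact: cg.
  exact: (cvg_pair c1 c2).
exact: cf.
Qed.

(** * The integral equation satisfied by [u^(n1)] *)

Section fractional_integral_equation.
Variables (R : realType) (d h B M : R) (m : nat) (c : nat -> R) (f : R -> R -> R).
Hypotheses (d01 : 0 <= d < 1) (h0 : 0 < h).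
Hypothesis cf : continuous (fun p : R * R => f p.1 p.2).
Hypothesis fM : forall s v, `|f s v| <= M.
Hypothesis uf : forall e, 0 < e -> exists2 r, 0 < r &
  forall s v v', `|v - v'| <= r -> `|f s v - f s v'| <= e.
Hypothesis tB : taylor_bound c M m.+1 h <= B.

(** [L] bounds on [[0, h]] the [m]-fold primitive whose primitive is [T w], hence is a Lipschitz
    constant; clamping the time in [T] extends both bounds to the whole line. *)
Let L := taylor_bound c M m h.
Let rhs (w : R -> R) (s : R) : R := f s (RLint d w s).
Let T (w : R -> R) (t : R) : R :=
  iter_primitive c (rhs w) m.+1 (clamp 0 h t).

Let M0 : 0 <= M. Proof. exact: le_trans (fM 0 0). Qed.

Let taylor_bound_ge0 i t : 0 <= t -> 0 <= taylor_bound c M i t.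
Proof.
move=> t0; rewrite addr_ge0//.
  by rewrite mulr_ge0// divr_ge0// exprn_ge0.
by apply: sumr_ge0 => j _; rewrite mulr_ge0// divr_ge0// exprn_ge0.
Qed.

Let continuous_rhs w : bounded_lipschitz B L w -> continuous (rhs w).
Proof.
move=> [wB wL]; apply: (continuous_comp_graph cf).
exact: (continuous_RLint d01 (lipschitz_continuous wL) wB).
Qed.

Let rhs_causal v w t : (forall s, 0 <= s <= t -> v s = w s) ->
  forall s, 0 <= s <= t -> rhs v s = rhs w s.
Proof.
move=> vw s /andP[s0 st]; rewrite /rhs (eq_RLint d s0 (w := w))// => r /andP[r0 rs].
by rewrite vw// r0 (le_trans rs).
Qed.

Lemma fractional_integral_equation : exists2 w, bounded_lipschitz B L w &
  forall t, 0 <= t <= h ->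
    w t = iter_primitive c (fun s => f s (RLint d w s)) m.+1 t.
Proof.
have h0' := ltW h0.
have B0 : 0 <= B by exact: le_trans (taylor_bound_ge0 _ h0') tB.
have L0 : 0 <= L by exact: taylor_bound_ge0.
have [w Xw wT] : exists2 w, bounded_lipschitz B L w &
    forall t, 0 <= t <= h -> w t = T w t; last first.
  by exists w => // t t0h; rewrite {1}wT// /T clamp_id.
apply: causal_fixpoint => //.
- move=> w Xw; have crw := continuous_rhs Xw.
  have rM s : `|rhs w s| <= M by exact: fM.
  split=> [t|].
    have /andP[t0 th] := clamp_itv t h0'.
    rewrite (le_trans (iter_primitive_bound c m.+1 crw rM t0))//.
    by rewrite (le_trans _ tB)// le_taylor_bound.
  have sorted_lip s t : s <= t -> `|T w t - T w s| <= L * `|t - s|.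
    move=> st; have /andP[s0 sh] := clamp_itv s h0'.
    have /andP[t0 th] := clamp_itv t h0'.
    have cst : clamp 0 h s <= clamp 0 h t.
      by rewrite /clamp; apply: le_max2 => //; apply: le_min2.
    rewrite (@le_trans _ _ (L * (clamp 0 h t - clamp 0 h s)))//; last first.
      by rewrite ler_wpM2l// (le_trans (ler_norm _))// clamp_lipschitz.
    apply: primitive_lipschitz => //; first exact: continuous_iter_primitive.
    move=> x /andP[sx xt]; have x0 := le_trans s0 sx.
    rewrite (le_trans (iter_primitive_bound c m crw rM x0))//.
    by rewrite le_taylor_bound// (le_trans xt).
  move=> s t; have [st|/ltW ts] := leP s t; last exact: sorted_lip.
  by rewrite distrC [`|s - t|]distrC sorted_lip.
- by move=> v w; rewrite /T clamp_id ?lexx//= !primitive_le0.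
- move=> v w t /andP[t0 th] vw; rewrite /T clamp_id ?t0//.
  by apply: eq_iter_primitive => //; exact: rhs_causal.
(* The moduli are chained: functions within [r / (C + 1)] have [J^d] within [r], hence right-hand
   sides within [e / h ^ (m + 1)], and [m + 1] integrations over [[0, h]] bring this to at most
   [e]. *)
- move=> e e0.
  have hm : 0 < h ^+ m.+1 by rewrite exprn_gt0.
  have [r r0 ur] := uf (divr_gt0 e0 hm).
  pose C := h `^ d / Gamma (d + 1).
  have C0 : 0 <= C by rewrite divr_ge0 ?powR_ge0// Gamma_ge0.
  have C1 : 0 < C + 1 by rewrite ltr_wpDl.
  exists (r / (C + 1)); first by rewrite divr_gt0.
  move=> v w Xv Xw vw t /andP[t0 th]; rewrite /T clamp_id ?t0//.
  have cv := lipschitz_continuous Xv.2; have cw := lipschitz_continuous Xw.2.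
  have cvw : continuous (fun s => v s - w s).
    by move=> s; apply: cvgB; [exact: cv|exact: cw].
  have close s : 0 <= s <= t -> `|rhs v s - rhs w s| <= e / h ^+ m.+1.
    move=> /andP[s0 st]; apply: ur.
    rewrite -(RLintB d01 cv cw Xv.1 Xw.1 s0).
    have sh : 0 <= s <= h by rewrite s0 (le_trans st).
    have := @RLint_bound _ _ d01 _ (r / (C + 1)) s h cvw sh.
    move=> /(_ _)/le_trans; apply.
      by move=> x /andP[x0 xs]; apply: vw; rewrite x0 (le_trans xs)// (le_trans st).
    by rewrite -/C mulrA ler_pdivrMr// mulrC ler_pM2l// lerDl.
  rewrite (le_trans (iter_primitive_dist c m.+1 (continuous_rhs Xv)
    (continuous_rhs Xw) close t0))//.
  rewrite mulrAC ler_pdivrMr// ler_pM2l// lerXn2r//.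
Qed.

End fractional_integral_equation.

(** For [x >= 0] the ceiling is nonnegative, so the absolute value in [ceiln] leaves it
    unchanged. *)
Lemma ceiln_itv (R : realType) (x : R) : 0 <= x -> 0 <= (ceiln x)%:R - x < 1.
Proof.
move=> x0; have -> : (ceiln x)%:R = (Num.ceil x)%:~R :> R.
  by rewrite /ceiln natr_absz ger0_norm// -(ceil0 R) ceil_le.
by have /andP[] := ceil_itv x; rewrite intrB => ? ?; apply/andP; split; lra.
Qed.

Lemma ceiln_nat (R : realType) (n : nat) : ceiln (n%:R : R) = n.
Proof. by rewrite /ceiln -[n%:R]/((Posz n)%:~R) intrKceil. Qed.

Lemma caputo_nat (R : realType) (U : nat -> R -> R) (n : nat) t :
  caputo U n%:R t = U n t.
Proof. by rewrite /caputo ceiln_nat subrr /RLint eqxx. Qed.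

Theorem theorem3p3 (R : realType) (k I alpha1 : R) (alpha2 : nat)
  (u0 : nat -> R) (f : R -> R -> R) :
  0 < k -> 0 < I -> 0 <= alpha1 -> alpha1 < alpha2%:R ->
  (forall n : nat, (0 < n)%N -> alpha1 != n%:R) ->
  (ceiln alpha1 + 1 <= alpha2)%N ->
  {within [set p : R * R | 0 <= p.1 <= I], continuous (fun p => f p.1 p.2)} ->
  let n1 := ceiln alpha1 in
  let G := [set p : R * R | 0 <= p.1 <= I /\
      `|p.2| <= powR I (n1%:R - alpha1) / Gamma (n1%:R - alpha1 + 1) *
        (k + \sum_(0 <= i < alpha2 - n1) I ^+ i / (i`!)%:R * `|u0 (i + n1)%N|)] in
  let M := sup [set `|f p.1 p.2| | p in G] in
  let h := if M == 0 then I
           else Num.min I (powR (k * Gamma ((alpha2 - n1)%:R + 1) / M)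
                                ((alpha2 - n1)%:R)^-1) in
  exists U : nat -> R -> R,
    Cm_on alpha2 h U /\
    (forall i, (i < alpha2)%N -> U i 0 = u0 i) /\
    (forall t, 0 <= t <= h ->
       caputo U alpha2%:R t = f t (caputo U alpha1 t)).
Proof.
move=> k0 I0 a10 _ _; rewrite addn1 => n1a2 cf n1.
have [m mE] : exists m, (alpha2 - n1 = m.+1)%N.
  by exists (alpha2 - n1).-1; rewrite prednK// subn_gt0.
rewrite mE; set d := n1%:R - alpha1; set B := k + _ => G M h.
have d01 : 0 <= d < 1 := ceiln_itv a10.
have I0' := ltW I0.
have B0 : 0 <= B.
  rewrite addr_ge0 ?(ltW k0)// sumr_ge0// => i _.
  by rewrite mulr_ge0// divr_ge0// exprn_ge0.
(* [V] is the half-height of [G]: by [RLint_bound], [|J^d w|] stays below it on [[0, I]] as soon as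
   [|w| <= B]. *)
pose V := I `^ d / Gamma (d + 1) * B.
have V0 : 0 <= V by rewrite mulr_ge0// divr_ge0 ?powR_ge0 ?Gamma_ge0.
pose f' := clamped f I V.
have f'M s v : `|f' s v| <= M by exact: clamped_le_sup.
have M0 : 0 <= M by exact: le_trans (f'M 0 0).
(* This is what [h] is chosen for: the leading term of the Taylor bound at [h] costs at most [k],
   and it vanishes if [M = 0]. *)
have [h0 hI hM] : [/\ 0 < h, h <= I & M * (h ^+ m.+1 / m.+1`!%:R) <= k].
  rewrite /h Gamma_nat; case: eqP => [->|/eqP Mn0].
    by split=> //; rewrite mul0r ltW.
  have Mgt0 : 0 < M by rewrite lt_neqAle eq_sym Mn0.
  have a0 : 0 < k * m.+1`!%:R / M by rewrite divr_gt0// mulr_gt0// ltr0n fact_gt0.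
  set r := _ `^ _; have r0 : 0 < r by rewrite powR_gt0.
  split; [by rewrite lt_min I0|by rewrite ge_min lexx|].
  set x := Num.min I r.
  have x0 : 0 <= x by rewrite le_min I0' ltW.
  have : x ^+ m.+1 <= k * m.+1`!%:R / M.
    rewrite (@le_trans _ _ (r ^+ m.+1))//.
      by rewrite lerXn2r ?nnegrE ?(ltW r0)// ge_min lexx orbT.
    rewrite -powR_mulrn ?(ltW r0)// /r -powRrM mulVf ?pnatr_eq0//.
    by rewrite powRr1// ltW.
  rewrite ler_pdivlMr// mulrC => H.
  by rewrite mulrA ler_pdivrMr// ltr0n fact_gt0.
(* Integration goes down from order [alpha2], so the initial values are listed in decreasing
   order. *)
pose c i := u0 (alpha2 - i.+1)%N.
have tB : taylor_bound c M m.+1 h <= B.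
  apply: lerD => //; rewrite big_mkord; apply: ler_sum => j _.
  have -> : c (m.+1.-1 - j)%N = u0 (j + n1)%N.
    rewrite /c /=; congr u0; have := ltn_ord j; move: mE n1a2; clear.
    move=> mE n1a2 jm; have -> : alpha2 = (m.+1 + n1)%N by rewrite -mE subnK// ltnW.
    by rewrite -subSn// addnC -addnBA ?leq_subr// subKn 1?addnC// ltnW.
  rewrite ler_wpM2r// ler_wpM2r ?invr_ge0// lerXn2r ?nnegrE ?(ltW h0)//.
have cf' : continuous (fun p : R * R => f' p.1 p.2) by exact: continuous_clamped.
have [w [wB wL] wE] := fractional_integral_equation d01 h0 cf' f'M
  (clamped_unif I0' V0 cf) tB.
have cw := lipschitz_continuous wL.
pose g s := f' s (RLint d w s).
have cg : continuous g.
  by apply: (continuous_comp_graph cf'); exact: (continuous_RLint d01 cw wB).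
(* [U alpha2] is [g] itself, and [U n1] coincides with [w] on [[0, h]] by [wE]; indices below [n1]
   only add integrations. *)
pose U j := iter_primitive c g (alpha2 - j).
have US j : (j < alpha2)%N -> U j = primitive (u0 j) (U j.+1).
  move=> ja; rewrite /U -[(alpha2 - j)%N]prednK ?subn_gt0// -subnS/=.
  by rewrite /c -subSn// subSS subKn// ltnW.
have cU j : continuous (U j) by exact: continuous_iter_primitive.
exists U; split; [split|split].
- move=> j ja t /andP[t0 _]; rewrite US//.
  exact: is_derive_within_primitive.
- exact: continuous_subspaceT.
- by move=> j ja; rewrite US// primitive_le0.
- move=> t /andP[t0 th].
  have -> : caputo U alpha1 t = RLint d w t.
    rewrite /caputo -/n1 -/d; apply: eq_RLint => // s /andP[s0 st].
    by rewrite /U mE wE// s0 (le_trans st).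
  (* Along the solution clamping is inactive, because [t <= I] and [|J^d w t| <= V], so [f'] agrees
     with [f] there. *)
  rewrite caputo_nat /U subnn /= /g /f' /clamped !clamp_id//.
    rewrite -ler_norml; apply: (RLint_bound d01 cw).
      by rewrite t0 (le_trans th).
    by move=> s _; exact: wB.
  by rewrite t0 (le_trans th).
Qed.
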